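(* Let $\mathbf{L} \in \mathbb{R}^{n\times n}$ be symmetric with spectrum contained in $[0,\Lambda]$, $\Lambda>0$, let $\phi$ be a function that is positive on $[0,\Lambda]$, and let $\mathrm{E}_W = [e_{\mathrm{w}_1},\ldots,e_{\mathrm{w}_N}]\in\mathbb{R}^{n\times N}$ be a block of $N$ distinct canonical unit vectors of $\mathbb{R}^n$. Let $m\ge 1$ and let $p_{\phi,m-1}^{(\mathrm{cbl})}(\mathbf{L})\mathrm{E}_W\in\mathbb{R}^{n\times N}$ be the output of $m$ steps of the classical block Lanczos method. Then the matrix $\mathrm{E}_W^*\, p_{\phi,m-1}^{(\mathrm{cbl})}(\mathbf{L})\mathrm{E}_W \in \mathbb{R}^{N\times N}$ is symmetric and positive definite.
   Context: $A^*$ denotes the transpose of a real matrix $A$. For a symmetric matrix $M$ with spectrum in $[0,\Lambda]$, $\phi(M)$ is defined through the spectral decomposition of $M$. The unit vectors $e_{\mathrm{w}_i}$ correspond to $N$ distinct sampling nodes $W=\{\mathrm{w}_1,\ldots,\mathrm{w}_N\}$ of a graph with $n$ vertices. Classical block Lanczos method. Set $\mathrm{Q}_0=0$, $\mathrm{H}_{0,1}=0$, $\mathrm{Q}_1=\mathrm{E}_W$. For $k=1,2,\ldots$ put $\mathrm{X}=\mathbf{L}\mathrm{Q}_k-\mathrm{Q}_{k-1}\mathrm{H}_{k-1,k}$, $\mathrm{H}_{k,k}=\mathrm{Q}_k^*\mathrm{X}$, replace $\mathrm{X}$ by $\mathrm{X}-\mathrm{Q}_k\mathrm{H}_{k,k}$,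 compute a reduced QR decomposition $\mathrm{X}=\mathrm{Q}_{k+1}\mathrm{H}_{k+1,k}$ with $\mathrm{Q}_{k+1}\in\mathbb{R}^{n\times N}$ having orthonormal columns and $\mathrm{H}_{k+1,k}\in\mathbb{R}^{N\times N}$ upper triangular, and set $\mathrm{H}_{k,k+1}=\mathrm{H}_{k+1,k}^*$. It is assumed that no breakdown occurs, i.e. the blocks $\mathrm{H}_{k+1,k}$, $k=1,\ldots,m-1$, needed to generate $\mathrm{Q}_1,\ldots,\mathrm{Q}_m$ are invertible. Let $\mathbf{H}_m\in\mathbb{R}^{mN\times mN}$ be the block tridiagonal matrix with diagonal blocks $\mathrm{H}_{k,k}$ ($1\le k\le m$), subdiagonal blocks $\mathrm{H}_{k+1,k}$ and superdiagonal blocks $\mathrm{H}_{k,k+1}$ ($1\le k\le m-1$), and let $\mathrm{F}_1\in\mathbb{R}^{mN\times N}$ have the identity $\mathbf{I}_N$ as its first $N\times N$ block and zeros elsewhere. The output is $$p_{\phi,m-1}^{(\mathrm{cbl})}(\mathbf{L})\mathrm{E}_W := [\mathrm{Q}_1,\ldots,\mathrm{Q}_m]\,\phi(\mathbf{H}_m)\,\mathrm{F}_1 ,$$ where the left-hand side is to be read as one symbol for an $n\times N$ matrix. *)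

(* Defs.v *)
From mathcomp Require Import all_boot all_order all_algebra.
From mathcomp Require Import classical_sets reals.

Set Implicit Arguments.
Unset Strict Implicit.
Unset Printing Implicit Defensive.
Import Order.TTheory GRing.Theory Num.Theory.
Local Open Scope ring_scope.

Definition posdef_mx (R : realType) (n : nat) (M : 'M[R]_n) : Prop :=
  forall x : 'cV[R]_n, x != 0 -> 0 < (x^T *m M *m x) 0 0.

(* Also used for rectangular matrices, where it does not imply Q *m Q^T = 1. *)
Definition orthonormal_cols (R : realType) (n p : nat) (Q : 'M[R]_(n, p)) :
  Prop := Q^T *m Q = 1%:M.

Definition spectral_dec (R : realType) (n : nat) (M : 'M[R]_n)
    (Ud : 'M[R]_n * 'rV[R]_n) : Prop :=
  orthonormal_cols Ud.1 /\ M = Ud.1 *m diag_mx Ud.2 *m Ud.1^T.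

(* phi(M) = U diag(phi d) U^T for a chosen spectral decomposition of M; by
   matfunE the choice does not matter. The default (0, 0) is only reached when
   M has no spectral decomposition, i.e. when M is not symmetric. *)
Definition matfun (R : realType) (n : nat) (phi : R -> R) (M : 'M[R]_n) :
    'M[R]_n :=
  let Ud := xget (0, 0) (spectral_dec M) in
  Ud.1 *m diag_mx (map_mx phi Ud.2) *m Ud.1^T.

Lemma matfunE (R : realType) (n : nat) (phi : R -> R) (M U : 'M[R]_n)
    (d : 'rV[R]_n) :
  spectral_dec M (U, d) ->
  matfun phi M = U *m diag_mx (map_mx phi d) *m U^T.
Proof.
move=> sM; rewrite /matfun.
have := xgetPex (0, 0) (ex_intro (spectral_dec M) _ sM).
case: (xget _ _) => V e /= [/= VV MV]; case: sM => /= UU MU.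
have VV' : V *m V^T = 1%:M by apply: mulmx1C.
have UU' : U *m U^T = 1%:M by apply: mulmx1C.
set W := V^T *m U.
have WE : W *m diag_mx d = diag_mx e *m W.
  have : M *m U = V *m diag_mx e *m V^T *m U by rewrite -MV.
  rewrite {1}MU -[U *m _ *m _ *m _]mulmxA UU mulmx1 => /(congr1 (mulmx V^T)).
  by rewrite /W !mulmxA VV mul1mx.
have WF : W *m diag_mx (map_mx phi d) = diag_mx (map_mx phi e) *m W.
  apply/matrixP => i j; move/matrixP/(_ i j): WE.
  rewrite !mul_mx_diag !mul_diag_mx !mxE.
  have [->|Wn0] := eqVneq (\sum_k V^T i k * U k j) 0.
    by rewrite !mul0r !mulr0.
  by rewrite ![_ * \sum_k _]mulrC => /(mulfI Wn0) ->.
have VW : V *m W = U by rewrite mulmxA VV' mul1mx.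
have WV : W *m U^T = V^T by rewrite -mulmxA UU' mulmx1.
by rewrite -WV mulmxA -(mulmxA V) -WF mulmxA VW.
Qed.

(* E_W, the block of canonical unit vectors indexed by the nodes w j. *)
Definition unit_block (R : realType) (n N : nat) (w : 'I_N -> 'I_n) :
    'M[R]_(n, N) :=
  \matrix_(i, j) (i == w j)%:R.

(* T is upper triangular: is_trig_mx means lower triangular. *)
Definition reduced_qr (R : realType) (n N : nat) (X Q : 'M[R]_(n, N))
    (T : 'M[R]_N) : Prop :=
  [/\ X = Q *m T, orthonormal_cols Q & is_trig_mx T^T].

Section BlockLanczos.
Variables (R : realType) (n N : nat).
Implicit Types (L : 'M[R]_n) (E : 'M[R]_(n, N)) (m k : nat).
Implicit Types (Q : nat -> 'M[R]_(n, N)) (H : nat -> nat -> 'M[R]_N).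

Definition cbl_residual L Q H k : 'M[R]_(n, N) :=
  L *m Q k - Q k.-1 *m H k.-1 k.

(* Q k and H k l are the blocks Q_k and H_{k,l} computed by m steps of the
   method started at E. QR factorizations are not unique, hence a relation.
   Only the blocks entering the output are constrained: the factorization
   following the m-th diagonal block is not required. *)
Record cbl_run L E m Q H : Prop := CblRun {
  cbl_Q0 : Q 0%N = 0;
  cbl_H01 : H 0%N 1%N = 0;
  cbl_Q1 : Q 1%N = E;
  cbl_diag : forall k, (1 <= k <= m)%N ->
    H k k = (Q k)^T *m cbl_residual L Q H k;
  cbl_qr : forall k, (1 <= k < m)%N ->
    reduced_qr (cbl_residual L Q H k - Q k *m H k k) (Q k.+1) (H k.+1 k);
  cbl_super : forall k, (1 <= k < m)%N -> H k k.+1 = (H k.+1 k)^T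
}.

Definition cbl_no_breakdown m H : Prop :=
  forall k, (1 <= k < m)%N -> H k.+1 k \in unitmx.

(* Block indices of mxblock, mxrow and mxcol start at 0, those of the method
   at 1. The dimension \sum_(i < m) N is m * N. *)
Definition cbl_H m H : 'M[R]_(\sum_(i < m) N) :=
  \mxblock_(i < m, j < m)
    (if [|| i == j, i == j.+1 :> nat | j == i.+1 :> nat]
     then H i.+1 j.+1 else 0).

Definition cbl_Q m Q : 'M[R]_(n, \sum_(j < m) N) := \mxrow_(j < m) Q j.+1.

Definition cbl_F1 m : 'M[R]_(\sum_(i < m) N, N) :=
  \mxcol_(i < m) (if i == 0%N :> nat then 1%:M else 0 : 'M[R]_N).

Definition cbl_output (phi : R -> R) m Q H : 'M[R]_(n, N) :=
  cbl_Q m Q *m matfun phi (cbl_H m H) *m cbl_F1 m.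

End BlockLanczos.

Arguments cbl_F1 R N m : clear implicits.

(* Main.v *)
Require Import Defs.
From mathcomp Require Import all_boot all_order all_algebra.
From mathcomp Require Import reals complex ring zify.

Set Implicit Arguments.
Unset Strict Implicit.
Unset Printing Implicit Defensive.
Import Order.TTheory GRing.Theory Num.Theory.
Local Open Scope ring_scope.

(** Write [E] for the block of unit vectors, [Qm] for the row [Q_1 ... Q_m] of
    Lanczos blocks, [F1] for the first block column of the identity and [Hm]
    for the block tridiagonal matrix.

    The Lanczos recurrence makes [Qm] have orthonormal columns
    ([cbl_Q_orthonormal]) and [Hm] the compression [Qm^T L Qm]
    ([cbl_compression]).  Since the first block is [Q_1 = E], also
    [E = Qm F1] ([cbl_Q_F1]), hence [E^T Qm = F1^T] and the matrix under study
    collapses to [F1^T phi(Hm) F1], a principal block of [phi(Hm)].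

    The Rayleigh quotients of a compression of [L] are Rayleigh quotients of
    [L], so every eigenvalue of [Hm] lies in [[0, Lambda]]
    ([compression_eigenvalue_bounds]).  There [phi] is positive, so [phi(Hm)]
    is symmetric positive definite, and so is its principal block
    ([posdef_congruence]).

    All this relies on the spectral theorem for real symmetric matrices
    ([symmetric_spectral_dec]).  It is deduced from the complex Hermitian one
    by induction on the size: the Hermitian theorem yields a real eigenvalue, a
    Householder reflection moves a unit eigenvector to the first basis vector,
    and symmetry splits off a block of size one. *)

(** * Spectral theorem for real symmetric matrices *)

Lemma symmetricmxP (R : fieldType) n (M : 'M[R]_n) :
  reflect (M^T = M) (M \is symmetricmx).
Proof.
rewrite is_hermitianmxE expr0 scale1r map_mx_id // eq_sym.
exact: eqP.
Qed.

(** Over the complex numbers a real symmetric matrix is Hermitian, so it is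
    diagonalizable with real eigenvalues; being an eigenvalue does not depend
    on the field. *)
Lemma symmetric_eigenvalue_exists (R : rcfType) n (M : 'M[R]_n) :
  (0 < n)%N -> M \is symmetricmx -> exists a, eigenvalue M a.
Proof.
move=> n_gt0 /symmetricmxP symM.
pose A : 'M[R[i]]_n := map_mx (real_complex R) M.
have herA : A \is hermsymmx.
  apply/is_hermitianmxP; rewrite expr0 scale1r /A -[in LHS]symM.
  by apply/matrixP => i j; rewrite !mxE conj_Creal // complex_real.
have /hermitian_normalmx/orthomx_spectralP := herA.
have /mxOverP/(_ 0 (Ordinal n_gt0))/complex_realP[a] :=
  hermitian_spectral_diag_real herA.
set d := spectral_diag A; set P := spectralmx A => da AE.
have Pu : P \in unitmx by apply: spectral_unit.
exists a; rewrite -(eigenvalue_map (real_complex R)) -/A; apply/eigenvalueP.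
exists (row (Ordinal n_gt0) P); last first.
  apply: contraTneq (Pu) => /rowP P0.
  rewrite unitmxE (expand_det_row _ (Ordinal n_gt0)) big1 ?unitr0 // => j _.
  by have := P0 j; rewrite !mxE => ->; rewrite mul0r.
rewrite -row_mul AE !mulmxA mulmxV // mul1mx mul_diag_mx.
by apply/rowP => j; rewrite !mxE da.
Qed.

Lemma rowV_sqnormE (R : realDomainType) n (v : 'rV[R]_n) :
  (v *m v^T) 0 0 = \sum_i v 0 i ^+ 2.
Proof. by rewrite mxE; apply: eq_bigr => i _; rewrite mxE expr2. Qed.

Lemma rowV_sqnorm_ge0 (R : realDomainType) n (v : 'rV[R]_n) :
  0 <= (v *m v^T) 0 0.
Proof. by rewrite rowV_sqnormE sumr_ge0 // => i _; rewrite sqr_ge0. Qed.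

Lemma rowV_sqnorm_eq0 (R : realDomainType) n (v : 'rV[R]_n) :
  ((v *m v^T) 0 0 == 0) = (v == 0).
Proof.
rewrite rowV_sqnormE psumr_eq0 => [|i _]; last by rewrite sqr_ge0.
apply/allP/eqP => [v0|-> i _]; last by rewrite mxE expr0n eqxx.
by apply/rowP => i; rewrite mxE; apply/eqP; rewrite -sqrf_eq0 (implyP (v0 i _)).
Qed.

(** The reflection exchanging the unit vectors [e] and [v]: its mirror is the
    hyperplane orthogonal to [e - v].  It serves to complete a unit vector to
    an orthonormal basis. *)
Lemma householder (R : realFieldType) n (e v : 'rV[R]_n) :
    e *m e^T = 1%:M -> v *m v^T = 1%:M ->
  exists2 P : 'M[R]_n, P *m P^T = 1%:M & e *m P = v.
Proof.
move=> ee vv; have [<-|nev] := eqVneq e v.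
  by exists 1%:M; rewrite ?trmx1 ?mulmx1.
pose u : 'rV[R]_n := e - v; pose s := (u *m u^T) 0 0; pose c := 2 / s.
have s0 : s != 0 by rewrite rowV_sqnorm_eq0 subr_eq0.
have uu : u *m u^T = s%:M by rewrite {1}[u *m _]mx11_scalar.
(* Both vectors have norm 1, so e.(e - v) is half of |e - v|^2. *)
have eu2 : e *m u^T = (s / 2)%:M.
  have ve : v *m e^T = e *m v^T.
    by rewrite [LHS]mx11_scalar -tr_scalar_mx -mx11_scalar trmx_mul trmxK.
  have eu : e *m u^T = 1%:M - e *m v^T by rewrite linearB mulmxBr ee.
  have su : s%:M = 2 *: (e *m u^T) :> 'M_1.
    rewrite -uu mulmxBl eu linearB /= mulmxBr vv ve.
    by rewrite scalerDl scale1r opprB.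
  apply: (@scalerI _ _ (2 : R)); rewrite ?pnatr_eq0 // -su.
  by rewrite scale_scalar_mx mulrC divfK ?pnatr_eq0.
exists (1%:M - c *: (u^T *m u)).
  set A := u^T *m u.
  have AT : A^T = A by rewrite trmx_mul trmxK.
  have AA : A *m A = s *: A.
    by rewrite /A mulmxA -(mulmxA u^T) uu mul_mx_scalar scalemxAl.
  have -> : (1%:M - c *: A)^T = 1%:M - c *: A.
    by rewrite linearB /= trmx1 [(_ *: _)^T]linearZ /= AT.
  rewrite mulmxBl !mulmxBr mulmx1 mul1mx.
  rewrite mulmx1 -scalemxAl -scalemxAr AA !scalerA -scalerBl.
  rewrite -addrA -opprD -scalerDl [X in X *: A](_ : _ = 0) ?scale0r ?subr0 //.
  by rewrite /c; field.
rewrite mulmxBr mulmx1 -scalemxAr mulmxA eu2 mul_scalar_mx scalerA.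
by rewrite mulrA divfK // divff ?pnatr_eq0 // scale1r subKr.
Qed.

(** Induction on the size: in an orthonormal basis starting with an eigenvector
    the first row of the matrix is [a e], and by symmetry so is its first
    column, which leaves a smaller symmetric matrix to diagonalize. *)
Lemma symmetric_spectral_dec (R : realType) n (M : 'M[R]_n) :
  M \is symmetricmx -> exists Ud, spectral_dec M Ud.
Proof.
elim: n M => [|n IHn] M symM.
  by exists (0, 0); split; apply/matrixP => -[].
have [a /eigenvalueP[v0 v0M v0_neq0]] :=
  symmetric_eigenvalue_exists (ltn0Sn n) symM.
pose s := (v0 *m v0^T) 0 0; have s_gt0 : 0 < s.
  by rewrite lt_def rowV_sqnorm_eq0 v0_neq0 rowV_sqnorm_ge0.
pose r := Num.sqrt s; pose v := r^-1 *: v0.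
have vM : v *m M = a *: v by rewrite -scalemxAl v0M !scalerA mulrC.
have vv : v *m v^T = 1%:M.
  rewrite linearZ /= -scalemxAl -scalemxAr scalerA -invfM -expr2.
  rewrite sqr_sqrtr ?ltW //.
  by rewrite [v0 *m _]mx11_scalar -/s scale_scalar_mx mulVf // gt_eqF.
pose e : 'rV[R]_(1 + n) := row_mx 1%:M 0.
have ee : e *m e^T = 1%:M.
  by rewrite tr_row_mx mul_row_col trmx1 mulmx1 mul0mx addr0.
have [P PP eP] := householder ee vv.
have PP' : P^T *m P = 1%:M by apply: mulmx1C.
move/symmetricmxP in symM.
pose B : 'M[R]_(1 + n) := P *m M *m P^T.
have BT : B^T = B by rewrite !trmx_mul trmxK symM mulmxA.
have eB : e *m B = a *: e.
  by rewrite !mulmxA eP vM -scalemxAl -eP -mulmxA PP mulmx1.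
have [ulB urB] : ulsubmx B = a%:M /\ ursubmx B = 0.
  move: eB; rewrite -[in LHS](submxK B) mul_row_block !mul1mx !mul0mx !addr0.
  rewrite scale_row_mx scaler0 scalemx1 => /eq_row_mx[-> ->].
  by [].
have dlB : dlsubmx B = 0 by rewrite -[RHS]trmx0 -urB trmx_ursub BT.
have [|[V d] [/= VV BE]] := IHn (drsubmx B).
  by apply/symmetricmxP; rewrite trmx_drsub BT.
pose W : 'M[R]_(1 + n) := block_mx 1%:M 0 0 V.
have WW : W^T *m W = 1%:M.
  rewrite tr_block_mx mulmx_block !trmx0 !trmx1 !mulmx0 !mul0mx !mul1mx VV.
  by rewrite !addr0 add0r -scalar_mx_block.
have BW : W *m diag_mx (row_mx a%:M d) *m W^T = B.
  rewrite tr_block_mx diag_mx_row !mulmx_block !trmx0 !trmx1 !mulmx0 !mul0mx.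
  rewrite !mulmx1 !mul1mx !addr0 !add0r -BE -[RHS]submxK.
  rewrite ulB urB dlB mul0mx; congr block_mx.
  by apply/matrixP=> i j; rewrite !ord1 !mxE.
exists (P^T *m W, row_mx a%:M d); split=> /=.
  by rewrite /orthonormal_cols trmx_mul trmxK mulmxA -(mulmxA _ P) PP mulmx1.
have -> : M = P^T *m B *m P by rewrite !mulmxA PP' mul1mx -mulmxA PP' mulmx1.
by rewrite trmx_mul trmxK -BW !mulmxA.
Qed.

Lemma spectral_dec_eigenvalue (R : realType) n (M U : 'M[R]_n) (d : 'rV[R]_n)
    i :
  spectral_dec M (U, d) -> eigenvalue M (d 0 i).
Proof.
move=> [/= UU ->]; apply/eigenvalueP; exists (row i U^T).
  rewrite -row_mul !mulmxA UU mul1mx mul_diag_mx.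
  by apply/rowP => j; rewrite !mxE.
apply: contra_neq (oner_neq0 R) => Ui0.
have /matrixP/(_ i i) := UU; rewrite [RHS]mxE eqxx /= mulr1n => <-.
rewrite mxE big1 // => k _; have /rowP/(_ k) := Ui0.
by rewrite !mxE => ->; rewrite mul0r.
Qed.

(** * Quadratic forms and functions of symmetric matrices *)

Lemma diag_quadE (R : comNzRingType) n (d y : 'rV[R]_n) :
  (y *m diag_mx d *m y^T) 0 0 = \sum_i d 0 i * y 0 i ^+ 2.
Proof.
rewrite mul_mx_diag mxE; apply: eq_bigr => i _.
by rewrite !mxE expr2 mulrA [d 0 i * _]mulrC.
Qed.

(** In an orthonormal eigenbasis the form is a combination of the eigenvalues
    weighted by the squared coordinates. *)
Lemma symmetric_quad_bounds (R : realType) n (M : 'M[R]_n) (lo hi : R) :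
    M \is symmetricmx -> (forall a, eigenvalue M a -> lo <= a <= hi) ->
  forall v : 'rV[R]_n,
    lo * (v *m v^T) 0 0 <= (v *m M *m v^T) 0 0 <= hi * (v *m v^T) 0 0.
Proof.
move=> /symmetric_spectral_dec[[U d] sM] specM v.
have d_bounds i : lo <= d 0 i <= hi := specM _ (spectral_dec_eigenvalue i sM).
case: sM => /= /mulmx1C UU ->.
pose y := v *m U.
have -> : v *m v^T = y *m y^T.
  by rewrite trmx_mul mulmxA -(mulmxA v) UU mulmx1.
have -> : v *m (U *m diag_mx d *m U^T) *m v^T = y *m diag_mx d *m y^T.
  by rewrite trmx_mul !mulmxA.
rewrite diag_quadE rowV_sqnormE !mulr_sumr.
by apply/andP; split; apply: ler_sum => i _; rewrite ler_wpM2r ?sqr_ge0 //;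
  case/andP: (d_bounds i).
Qed.

(** An eigenvector [x] of the compression gives the Rayleigh quotient [a] at
    [x], and this is the Rayleigh quotient of [M] at [x *m Q^T], a vector of
    the same norm. *)
Lemma compression_eigenvalue_bounds (R : realType) n p (M : 'M[R]_n)
    (Q : 'M[R]_(n, p)) (lo hi : R) :
    M \is symmetricmx -> (forall a, eigenvalue M a -> lo <= a <= hi) ->
    orthonormal_cols Q ->
  forall a, eigenvalue (Q^T *m M *m Q) a -> lo <= a <= hi.
Proof.
move=> symM specM QQ a /eigenvalueP[x xE x_neq0].
have x_gt0 : 0 < (x *m x^T) 0 0.
  by rewrite lt_def rowV_sqnorm_eq0 x_neq0 rowV_sqnorm_ge0.
have := symmetric_quad_bounds symM specM (x *m Q^T).
have -> : (x *m Q^T) *m (x *m Q^T)^T = x *m x^T.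
  by rewrite trmx_mul trmxK mulmxA -(mulmxA x) QQ mulmx1.
have -> : (x *m Q^T *m M *m (x *m Q^T)^T) 0 0 = a * (x *m x^T) 0 0.
  have -> : x *m Q^T *m M *m (x *m Q^T)^T = a *: (x *m x^T).
    by rewrite trmx_mul trmxK scalemxAl -xE !mulmxA.
  by rewrite mxE.
by rewrite !ler_pM2r.
Qed.

Lemma symmetric_congruence (R : fieldType) n p (M : 'M[R]_n)
    (B : 'M[R]_(n, p)) :
  M \is symmetricmx -> B^T *m M *m B \is symmetricmx.
Proof.
move=> /symmetricmxP MT; apply/symmetricmxP.
by rewrite !trmx_mul trmxK MT mulmxA.
Qed.

(** Orthonormality of the columns enters through the injectivity of [B]. *)
Lemma posdef_congruence (R : realType) n p (M : 'M[R]_n) (B : 'M[R]_(n, p)) :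
  posdef_mx M -> orthonormal_cols B -> posdef_mx (B^T *m M *m B).
Proof.
move=> posM BB x x_neq0; have := posM (B *m x).
rewrite trmx_mul !mulmxA; apply; apply: contra_neq x_neq0 => Bx0.
by rewrite -[x]mul1mx -BB -mulmxA Bx0 mulmx0.
Qed.

Lemma matfun_symmetric (R : realType) n (phi : R -> R) (M : 'M[R]_n) :
  M \is symmetricmx -> matfun phi M \is symmetricmx.
Proof.
move=> /symmetric_spectral_dec[[U d] /matfunE->]; apply/symmetricmxP.
by rewrite !trmx_mul trmxK tr_diag_mx mulmxA.
Qed.

Lemma matfun_posdef (R : realType) n (phi : R -> R) (M : 'M[R]_n) :
    M \is symmetricmx -> (forall a, eigenvalue M a -> 0 < phi a) ->
  posdef_mx (matfun phi M).
Proof.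
move=> /symmetric_spectral_dec[[U d] sM] phi_gt0; rewrite (matfunE phi sM).
have phid_gt0 i : 0 < phi (d 0 i) := phi_gt0 _ (spectral_dec_eigenvalue i sM).
case: sM => /= UU _.
rewrite -{1}[U]trmxK; apply: posdef_congruence; last first.
  by rewrite /orthonormal_cols trmxK; apply: mulmx1C.
move=> x x_neq0; pose y := x^T.
have [i yi_neq0] : exists i, y 0 i != 0.
  apply/existsP; apply: contra_neqT x_neq0 => /existsPn y0.
  apply: trmx_inj; apply/rowP => i; rewrite trmx0 [RHS]mxE.
  by apply/eqP/negPn/y0.
rewrite -/y -[x]trmxK -/y diag_quadE (bigD1 i) //= ltr_wpDr //.
  by apply: sumr_ge0 => j _; rewrite mulr_ge0 ?sqr_ge0 // mxE ltW.
rewrite mulr_gt0 ?exprn_even_gt0 //=.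
by rewrite mxE.
Qed.

(** * Block Lanczos runs *)

Section BlockLanczosRun.
Variables (R : realType) (n N m : nat) (L : 'M[R]_n) (E : 'M[R]_(n, N)).
Variables (Q : nat -> 'M[R]_(n, N)) (H : nat -> nat -> 'M[R]_N).
Hypothesis L_sym : L \is symmetricmx.
Hypothesis E_ortho : orthonormal_cols E.
Hypothesis run : cbl_run L E m Q H.
Hypothesis no_breakdown : cbl_no_breakdown m H.

(** At [k = 1] the last term vanishes, since [Q 0 = 0]. *)
Lemma cbl_recurrence k : (1 <= k < m)%N ->
  L *m Q k = Q k.+1 *m H k.+1 k + Q k *m H k k + Q k.-1 *m H k.-1 k.
Proof. by move=> km; have [<- _ _] := cbl_qr run km; rewrite !subrK. Qed.

(** Induction on the number of blocks.  With [T = H_(k+1,k)], the QR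
    factorization makes [Q_(k+1) T] equal to [L Q_k] minus its components along
    [Q_k] and [Q_(k-1)]; an earlier [Q_j] needs no subtraction, because
    [Q_j^T L Q_k = (L Q_j)^T Q_k] and by the recurrence [L Q_j] only involves
    blocks up to [Q_(j+1)].  Invertibility of [T] transfers orthogonality from
    [Q_(k+1) T] to [Q_(k+1)]. *)
Lemma cbl_orthogonal i j : (1 <= i <= m)%N -> (1 <= j <= m)%N ->
  (Q i)^T *m Q j = 1%:M *+ (i == j).
Proof.
have sym a b : (Q a)^T *m Q b = 1%:M *+ (a == b) ->
    (Q b)^T *m Q a = 1%:M *+ (b == a).
  by move=> ab; rewrite -[LHS]trmxK trmx_mul trmxK ab raddfMn /= trmx1 eq_sym.
suff lower k : (k <= m)%N -> forall j i, (1 <= j <= i)%N -> (i <= k)%N ->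
    (Q j)^T *m Q i = 1%:M *+ (j == i).
  move=> i_rng j_rng; have [ij|ji] := leqP i j; last apply: sym.
    by apply: (lower m) => //; lia.
  by apply: (lower m) => //; lia.
elim: k => [|k IHk] km {i}j {}i /andP[j_gt0 ji]; first by lia.
have {}IHk := IHk (ltnW km).
rewrite leq_eqVlt ltnS => /predU1P[ik|ik]; last by apply: IHk; rewrite ?j_gt0.
rewrite {i}ik in ji *; have [k0|k_gt0] := posnP k.
  have -> : j = 1%N by lia.
  by rewrite k0 (cbl_Q1 run) E_ortho.
have kr : (1 <= k < m)%N by lia.
have [X_qr QQ _] := cbl_qr run kr.
have [->|j_neq] := eqVneq j k.+1; first exact: QQ.
have jk : (j <= k)%N by lia.
have unitT := no_breakdown kr.
rewrite -[_ *m _](mulmxK unitT) -(mulmxA _ (Q k.+1)) -X_qr.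
suff -> : (Q j)^T *m (cbl_residual L Q H k - Q k *m H k k) = 0.
  by rewrite mul0mx /=.
have IH a b : (1 <= a <= k)%N -> (1 <= b <= k)%N ->
    (Q a)^T *m Q b = 1%:M *+ (a == b).
  move=> a_rng b_rng; have [ab|ba] := leqP a b; last apply: sym.
    by apply: IHk; lia.
  by apply: IHk; lia.
have {jk} [->|j_neq_k] := eqVneq j k.
  rewrite mulmxBr mulmxA IH ?k_gt0 ?leqnn // eqxx mul1mx.
  by rewrite (cbl_diag run) ?subrr //; lia.
have jk' : (j < k)%N by lia.
rewrite mulmxBr (mulmxA _ (Q k)) IH; [|lia|lia].
rewrite (negPf j_neq_k) /= mul0mx subr0 mulmxBr.
(* Moving L to the left factor uses the recurrence at j instead of k. *)
have -> : (Q j)^T *m (L *m Q k) = (H j.+1 j)^T *+ (j.+1 == k).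
  have LT : L^T = L by apply/symmetricmxP.
  rewrite mulmxA -[in LHS]LT -trmx_mul cbl_recurrence; last by lia.
  rewrite !linearD /= !trmx_mul !mulmxDl -!mulmxA.
  rewrite IH; [|lia|lia]; rewrite IH; [|lia|lia].
  rewrite (negPf j_neq_k) /= mulmx0 addr0.
  have -> B b : B *m (1%:M *+ b) = B *+ b :> 'M[R]_N.
    by rewrite raddfMn /= mulmx1.
  have [->|j1_gt0] := posnP j.-1.
    by rewrite (cbl_Q0 run) trmx0 mul0mx mulmx0 addr0.
  rewrite IH; [|lia|lia]; rewrite [_ == k]eqn_leq leqNgt.
  have -> : (j.-1 == k) = false by lia.
  by rewrite /= mulmx0 addr0.
have [jk1|jk1] := eqVneq j.+1 k.
  rewrite -jk1 /= mulmxA IH; [|lia|lia].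
  by rewrite eqxx mul1mx (cbl_super run) ?subrr //; lia.
rewrite mulmxA IH; [|lia|lia].
have -> : (j == k.-1) = false by lia.
by rewrite /= mul0mx subr0.
Qed.

Lemma cbl_Q_orthonormal : orthonormal_cols (cbl_Q m Q).
Proof.
rewrite /orthonormal_cols tr_mxrow mul_mxcol_mxrow -(mxdiagZ 1).
apply: eq_mxblock => i j; rewrite cbl_orthogonal; [|exact: ltn_ord..].
rewrite eqSS; have [ij|nij] := eqVneq (i : nat) j.
  by move: (ord_inj ij) => ->; rewrite eqxx conform_mx_id.
by rewrite ifN.
Qed.

(** Below the diagonal the blocks are read off the recurrence, which is only
    available for columns [j < m]; the blocks above follow by symmetry, and the
    diagonal ones, including the last, from the definition of [H k k]. *)
Lemma cbl_compression : (cbl_Q m Q)^T *m L *m cbl_Q m Q = cbl_H m H.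
Proof.
have LT : L^T = L by apply/symmetricmxP.
have sub i j : (1 <= j < i)%N -> (i <= m)%N ->
    (Q i)^T *m (L *m Q j) = H i j *+ (i == j.+1).
  move=> ji im; rewrite cbl_recurrence; last by lia.
  rewrite !mulmxDr !mulmxA.
  rewrite cbl_orthogonal; [|lia|lia]; rewrite cbl_orthogonal; [|lia|lia].
  have -> : (i == j) = false by lia.
  have -> : (Q i)^T *m Q j.-1 = 0.
    have [->|j1_gt0] := posnP j.-1; first by rewrite (cbl_Q0 run) mulmx0.
    rewrite cbl_orthogonal; try lia.
    by have -> : (i == j.-1) = false by lia.
  rewrite /= !mul0mx !addr0.
  by have [->|_] := eqVneq i j.+1; rewrite /= ?mul1mx ?mul0mx.
rewrite -mulmxA mul_mxrow tr_mxrow mul_mxcol_mxrow.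
apply: eq_mxblock => i j.
have im := ltn_ord i; have jm := ltn_ord j.
have [ij|ji|ij] := ltngtP (i : nat) j.
- apply: trmx_inj; rewrite !trmx_mul LT trmxK -mulmxA sub ?ltnS //.
  have -> : (i == j) = false by apply/eqP => /(congr1 val) /=; lia.
  have -> : (i == j.+1 :> nat) = false by lia.
  rewrite eqSS /=; have [->|_] := eqVneq; last by rewrite trmx0.
  by rewrite (cbl_super run) ?trmxK //; lia.
- rewrite sub ?ltnS //.
  have -> : (i == j) = false by apply/eqP => /(congr1 val) /=; lia.
  have -> : (j == i.+1 :> nat) = false by lia.
  by rewrite eqSS orbF /=; case: eqP.
- move: (ord_inj ij) => <-; rewrite eqxx /= (cbl_diag run); last by lia.
  rewrite mulmxBr /=; suff -> : (Q i.+1)^T *m (Q i *m H i i.+1) = 0.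
    by rewrite subr0.
  have [->|i_gt0] := posnP i; first by rewrite (cbl_Q0 run) mul0mx mulmx0.
  rewrite mulmxA cbl_orthogonal; try lia.
  have -> : (i.+1 == i) = false by lia.
  by rewrite mul0mx.
Qed.

Lemma cbl_Q_F1 : (1 <= m)%N -> cbl_Q m Q *m cbl_F1 R N m = E.
Proof.
move=> m_gt0; rewrite mul_mxrow_mxcol (bigD1 (Ordinal m_gt0)) //=.
rewrite mulmx1 (cbl_Q1 run) big1 ?addr0 // => i i_neq0.
by rewrite ifN ?mulmx0.
Qed.

End BlockLanczosRun.

Lemma unit_block_orthonormal (R : realType) n N (w : 'I_N -> 'I_n) :
  injective w -> orthonormal_cols (unit_block R w).
Proof.
move=> w_inj; apply/matrixP => i j; rewrite !mxE (bigD1 (w i)) //=.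
rewrite !mxE eqxx mul1r (inj_eq w_inj) big1 ?addr0 // => k k_neq.
by rewrite !mxE (negPf k_neq) mul0r.
Qed.

Theorem theorem3p1 (R : realType) (n N m : nat) (L : 'M[R]_n) (Lambda : R)
  (phi : R -> R) (w : 'I_N -> 'I_n)
  (Q : nat -> 'M[R]_(n, N)) (H : nat -> nat -> 'M[R]_N)
  (Lambda_gt0 : 0 < Lambda)
  (L_sym : L \is symmetricmx)
  (L_spec : forall a : R, eigenvalue L a -> 0 <= a <= Lambda)
  (phi_gt0 : forall x : R, 0 <= x <= Lambda -> 0 < phi x)
  (w_inj : injective w)
  (m_ge1 : (1 <= m)%N)
  (run : cbl_run L (unit_block R w) m Q H)
  (no_breakdown : cbl_no_breakdown m H) :
  (unit_block R w)^T *m cbl_output phi m Q H \is symmetricmx /\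
  posdef_mx ((unit_block R w)^T *m cbl_output phi m Q H).
Proof.
have E_ortho := unit_block_orthonormal R w_inj.
have Q_ortho := cbl_Q_orthonormal L_sym E_ortho run no_breakdown.
have HE := cbl_compression L_sym E_ortho run no_breakdown.
have QF1 := cbl_Q_F1 run m_ge1.
set F1 := cbl_F1 R N m in QF1.
have EQ : (unit_block R w)^T *m cbl_Q m Q = F1^T.
  by rewrite -QF1 trmx_mul -mulmxA Q_ortho mulmx1.
have F1_ortho : orthonormal_cols F1.
  by rewrite /orthonormal_cols -EQ -mulmxA QF1.
have H_sym : cbl_H m H \is symmetricmx.
  by rewrite -HE; apply: symmetric_congruence.
have H_spec : forall a, eigenvalue (cbl_H m H) a -> 0 <= a <= Lambda.
  rewrite -HE; exact: compression_eigenvalue_bounds.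
have -> : (unit_block R w)^T *m cbl_output phi m Q H =
    F1^T *m matfun phi (cbl_H m H) *m F1.
  by rewrite mulmxA (mulmxA _ (cbl_Q m Q)) EQ.
split.
  by apply/symmetric_congruence/matfun_symmetric.
apply: posdef_congruence => //; apply: matfun_posdef => // a /H_spec.
exact: phi_gt0.
Qed.
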